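(* Let $\Gamma$ be a lattice in $\mathbb{R}^d$ and let $(v,R)\in E(d)$ be an isometry of $\mathbb{R}^d$. Then $(v,R)$ is an affine coincidence isometry of $\Gamma$ if and only if $R\in \mathrm{OC}(\Gamma)$ and $v\in\Gamma+R\Gamma$.
   Context: A lattice in $\mathbb{R}^d$ is the $\mathbb{Z}$-span of $d$ linearly independent vectors of $\mathbb{R}^d$; a sublattice of $\Gamma$ is a subgroup of finite index. $E(d)$ is the group of isometries of $\mathbb{R}^d$; its elements are written $(v,R)$ with $v\in\mathbb{R}^d$, $R\in \mathrm{O}(d)$, acting by $x\mapsto v+R(x)$. Two lattices are commensurate if their intersection is a sublattice (finite index subgroup) of both. $\mathrm{OC}(\Gamma)$ is the set of linear coincidence isometries of $\Gamma$, i.e. of all $R\in \mathrm{O}(d)$ such that $\Gamma$ and $R\Gamma$ are commensurate. $\Gamma+R\Gamma=\{a+Rb: a,b\in\Gamma\}$. A cosublattice of $\Gamma$ is a coset $\ell+\Gamma'$ with $\ell\in\Gamma$ and $\Gamma'$ a sublattice of $\Gamma$. An isometry $(v,R)\in E(d)$ is an affine coincidence isometry of $\Gamma$ if $\Gamma\cap (v,R)\Gamma$ contains a cosublattice of $\Gamma$. *)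

(* Defs.v *)
From mathcomp Require Import all_boot all_order all_algebra.
From mathcomp Require Import boolp classical_sets functions cardinality reals.

Set Implicit Arguments.
Unset Strict Implicit.
Unset Printing Implicit Defensive.

Import GRing.Theory.
Local Open Scope classical_set_scope.
Local Open Scope ring_scope.

Section Lattices.
Variables (R : realType) (d : nat).
Implicit Types (G H : set 'cV[R]_d) (Q : 'M[R]_d) (g : 'cV[R]_d * 'M[R]_d).

Definition Zspan (b : d.-tuple 'cV[R]_d) : set 'cV[R]_d :=
  [set x | exists z : 'I_d -> int, x = \sum_(i < d) tnth b i *~ z i].

Definition lattice G : Prop :=
  exists2 b : d.-tuple 'cV[R]_d, free b & G = Zspan b.

Definition translate (l : 'cV[R]_d) H : set 'cV[R]_d := [set l + x | x in H].

(* A subgroup of finite index: the set of cosets [a + H], [a] in [G], is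
   finite. *)
Definition sublattice H G : Prop :=
  [/\ H `<=` G, zmod_closed [in H] & finite_set [set translate a H | a in G]].

Definition commensurate G H : Prop :=
  sublattice (G `&` H) G /\ sublattice (G `&` H) H.

Definition cosublattice (C G : set 'cV[R]_d) : Prop :=
  exists l H, [/\ G l, sublattice H G & C = translate l H].

(* O(d), as the matrices acting on column vectors by left multiplication. *)
Definition orthogonal_group : set 'M[R]_d := [set Q | Q^T *m Q = 1%:M].

Definition lin_image Q G : set 'cV[R]_d := [set Q *m x | x in G].

Definition OC G : set 'M[R]_d :=
  [set Q | orthogonal_group Q /\ commensurate G (lin_image Q G)].

(* E(d): the pair [(v, Q)] stands for the isometry [x |-> v + Q x]. *)
Definition euclidean_group : set ('cV[R]_d * 'M[R]_d) :=
  [set g | orthogonal_group g.2].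

Definition isom_act g (x : 'cV[R]_d) : 'cV[R]_d := g.1 + g.2 *m x.

Definition affine_coincidence_isometry G : set ('cV[R]_d * 'M[R]_d) :=
  [set g | euclidean_group g /\
     exists2 C, cosublattice C G & C `<=` G `&` (isom_act g @` G)].

Definition lattice_sum G H : set 'cV[R]_d := [set a + b | a in G & b in H].

End Lattices.

(* Main.v *)
Require Import Defs.
From mathcomp Require Import all_boot all_order all_algebra.
From mathcomp Require Import boolp classical_sets functions cardinality reals.

(** Write [G] for the lattice and [Q G] for its image under [Q].

    A coset [l + H] contained in [v + Q G] pins [v] down modulo [Q G]: its point
    [l] is [v + Q y] with [y] in [G], so [v] lies in [G + Q G], and the
    differences of its points show that [H] is contained in [Q G] too.  Hence
    [H] is contained in the intersection of [G] and [Q G], which inherits finite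
    index in [G] from [H].  Conversely, if [v = a + Q b], then [v + Q G] is
    [a + Q G], and it contains the coset of [a] modulo that intersection.

    The remaining point is that the intersection also has finite index in
    [Q G], whereas the index of [H] is known to be finite only in [G].  This is
    where the ranks of the lattices matter
    ([sublattice_in_other_lattice]).  A subgroup [H] of finite index in a lattice
    contains the integral span of an invertible matrix [C]
    ([sublattice_full_rank]).  If [H] lies in a second lattice with basis matrix
    [B], then [C = B Z] with [Z] integral and [det Z] nonzero, and multiplying
    by the adjugate of [Z] gives [det Z * B = C adj Z]; so [det Z] times the second
    lattice lies in [H] ([int_span_multiple]).  A subgroup that contains a nonzero
    multiple of a lattice has finite index in it, because coordinates may be
    reduced modulo the multiplier ([sublattice_of_multiple]). *)

Set Implicit Arguments.
Unset Strict Implicit.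
Unset Printing Implicit Defensive.

Import Order.TTheory GRing.Theory Num.Theory.
Local Open Scope classical_set_scope.
Local Open Scope ring_scope.

(** * Subgroups and cosets *)

Section Subgroups.
Variables (R : realType) (d : nat).
Implicit Types (G H K : set 'cV[R]_d) (x y a : 'cV[R]_d).

Lemma subgroup0 H : zmod_closed [in H] -> H 0.
Proof. by case=> H0 _; have := H0; rewrite inE. Qed.

Lemma subgroupB H x y : zmod_closed [in H] -> H x -> H y -> H (x - y).
Proof. by case=> _ HB Hx Hy; have := HB x y; rewrite !inE; apply. Qed.

Lemma subgroupD H x y : zmod_closed [in H] -> H x -> H y -> H (x + y).
Proof.
move=> cH Hx Hy; rewrite -[y]opprK -[- y]sub0r.
by do 2![apply: subgroupB => //]; apply: subgroup0.
Qed.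

Lemma subgroupMz H x (n : int) : zmod_closed [in H] -> H x -> H (x *~ n).
Proof.
move=> cH Hx; have HMn m : H (x *+ m).
  elim: m => [|m IHm]; first by rewrite mulr0n; apply: subgroup0.
  by rewrite mulrS; apply: subgroupD.
case: n => m; first exact: HMn.
rewrite NegzE mulrNz -[- _]sub0r.
by apply: subgroupB => //; [apply: subgroup0 | apply: HMn].
Qed.

Lemma subgroup_sum H (I : finType) (F : I -> 'cV[R]_d) :
  zmod_closed [in H] -> (forall i, H (F i)) -> H (\sum_i F i).
Proof.
move=> cH HF; apply: (big_ind H) => //; first exact: subgroup0.
by move=> x y; apply: subgroupD.
Qed.

Lemma subgroupI G H :
  zmod_closed [in G] -> zmod_closed [in H] -> zmod_closed [in G `&` H].
Proof.
move=> cG cH; split=> [|x y]; rewrite !inE.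
  by split; apply: subgroup0.
by move=> [Gx Hx] [Gy Hy]; split; apply: subgroupB.
Qed.

Lemma translate_eq H x y : zmod_closed [in H] -> H (y - x) ->
  translate x H = translate y H.
Proof.
move=> cH Hyx; apply/seteqP; split=> _ [h Hh <-].
  exists (h - (y - x)); first exact: subgroupB.
  by rewrite opprB addrCA subrKC addrC.
exists (h + (y - x)); first exact: subgroupD.
by rewrite addrCA subrKC addrC.
Qed.

(** The coset of [a] modulo [K] is the set of sums of its coset modulo [H] and
    [K], so the finitely many cosets of [H] determine all those of [K]. *)
Lemma sublatticeS G H K : zmod_closed [in K] ->
  H `<=` K -> K `<=` G -> sublattice H G -> sublattice K G.
Proof.
move=> cK HK KG [_ cH finH]; split=> //.
have coset_sum a : translate a K = lattice_sum (translate a H) K.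
  apply/seteqP; split=> [_ [k Kk <-]|_ [_ [h Hh <-]] [k Kk <-]].
    exists (a + 0); first by exists 0 => //; apply: subgroup0.
    by exists k => //; rewrite addr0.
  by exists (h + k); rewrite ?addrA //; apply: subgroupD => //; apply: HK.
apply: sub_finite_set (finite_image (fun C => lattice_sum C K) finH).
move=> _ [a Ga <-]; exists (translate a H); first by exists a.
exact/esym/coset_sum.
Qed.

(** Pigeonhole: two of the multiples of [x] fall into the same coset. *)
Lemma sublattice_multiple G H x : zmod_closed [in G] -> sublattice H G ->
  G x -> exists2 m : nat, (0 < m)%N & H (x *+ m).
Proof.
move=> cG [_ cH finH] Gx; apply: contrapT => noM.
pose f n := translate (x *+ n) H.
have f_lt i j : (i < j)%N -> f i <> f j.
  move=> ltij eqf; apply: noM; exists (j - i)%N; first by rewrite subn_gt0.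
  have : f j (x *+ j) by exists 0; [apply: subgroup0 | rewrite addr0].
  rewrite -eqf => -[h Hh def_j].
  by rewrite mulrnBr ?(ltnW ltij) // -def_j addrAC subrr add0r.
have f_inj : injective f.
  by move=> i j eqf; case: (ltngtP i j) => // /f_lt; [|move/nesym].
apply: infinite_nat.
have sub : [set: nat] `<=` f @^-1` [set translate a H | a in G].
  move=> n _; exists (x *+ n) => //.
  by rewrite pmulrn; apply: subgroupMz.
apply: sub_finite_set sub _; apply: finite_preimage => // i j _ _.
exact: f_inj.
Qed.

End Subgroups.

(** * Integral spans of the columns of a matrix *)

Section IntegralSpans.
Variables (R : realType) (d : nat).
Implicit Types (G H K : set 'cV[R]_d) (B C Q : 'M[R]_d).

Definition int_span B : set 'cV[R]_d :=
  [set B *m map_mx intr z | z in [set: 'cV[int]_d]].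

Lemma lattice_int_span G :
  lattice G -> exists2 B : 'M[R]_d, B \in unitmx & G = int_span B.
Proof.
move=> [b free_b ->]; pose B := \matrix_(i < d, j < d) tnth b j i 0.
have mulB (u : 'cV[R]_d) : B *m u = \sum_j u j 0 *: tnth b j.
  apply/colP=> i; rewrite mxE summxE; apply: eq_bigr => j _.
  by rewrite !mxE mulrC.
exists B.
  rewrite unitmxE unitfE -det_tr; apply/negP => /det0P[u nz_u uB0].
  case/eqP: nz_u; apply/rowP => j; rewrite mxE.
  have /freeP := free_b; apply.
  have := mulB u^T; rewrite -[B]trmxK -trmx_mul uB0 trmx0 => /esym sum0.
  rewrite -[RHS]sum0; apply: eq_bigr => i _.
  by rewrite mxE (tnth_nth 0).
apply/seteqP; split=> [_ [z ->]|_ [z _ <-]].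
  exists (\col_i z i) => //; rewrite mulB; apply: eq_bigr => i _.
  by rewrite !mxE scaler_int.
exists (fun i => z i 0); rewrite mulB; apply: eq_bigr => i _.
by rewrite mxE scaler_int.
Qed.

Lemma lin_image_int_span Q B : lin_image Q (int_span B) = int_span (Q *m B).
Proof.
apply/seteqP; split=> [_ [_ [z _ <-] <-]|_ [z _ <-]].
  by exists z => //; rewrite mulmxA.
by exists (B *m map_mx intr z); [exists z | rewrite mulmxA].
Qed.

Lemma int_span_subgroup B : zmod_closed [in int_span B].
Proof.
split=> [|x y]; rewrite !inE; first by exists 0 => //; rewrite map_mx0 mulmx0.
move=> [z _ <-] [t _ <-]; exists (z - t) => //.
by rewrite map_mxB mulmxBr.
Qed.

Lemma int_span_col B j : int_span B (col j B).
Proof. by exists (delta_mx j 0) => //; rewrite map_delta_mx -colE. Qed.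

(** Each column of [B] has a positive multiple in [H]; these multiples are the
    columns of [B] times an invertible diagonal matrix. *)
Lemma sublattice_full_rank B H : B \in unitmx -> sublattice H (int_span B) ->
  exists2 C : 'M[R]_d, C \in unitmx & int_span C `<=` H.
Proof.
move=> uB subH; have cH : zmod_closed [in H] by case: subH.
have colM j : exists m : nat, (0 < m)%N /\ H (col j B *+ m).
  have [m m_gt0 Hm] := sublattice_multiple (int_span_subgroup B) subH
    (int_span_col B j).
  by exists m.
have [m mP] := choice colM.
pose D : 'rV[R]_d := \row_j (m j)%:R.
exists (B *m diag_mx D).
  rewrite unitmx_mul uB unitmxE unitfE det_diag; apply/prodf_neq0 => j _.
  by rewrite mxE pnatr_eq0 -lt0n; case: (mP j).
move=> _ [z _ <-].
have -> : B *m diag_mx D *m map_mx intr z = \sum_j (col j B *+ m j) *~ z j 0.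
  apply/colP=> i; rewrite !mxE summxE; apply: eq_bigr => j _.
  by rewrite -scaler_int -scaler_nat mul_mx_diag !mxE mulrC [_ * (m j)%:R]mulrC.
by apply: subgroup_sum => // j; apply: subgroupMz => //; case: (mP j).
Qed.

(** If [C = B Z] then [det Z * B = C adj Z], with [adj Z] integral. *)
Lemma int_span_multiple B C : C \in unitmx -> int_span C `<=` int_span B ->
  exists2 n : int, n != 0 & forall x, int_span B x -> int_span C (x *~ n).
Proof.
move=> uC CB.
have colZ j : exists z : 'cV[int]_d, B *m map_mx intr z = col j C.
  by have [z _ def_z] := CB _ (int_span_col C j); exists z.
have [z def_z] := choice colZ.
pose Z : 'M[int]_d := \matrix_(i, j) z j i 0.
have def_C : C = B *m map_mx intr Z.
  apply/matrixP => i j; have /colP/(_ i) := def_z j; rewrite [in RHS]mxE => <-.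
  by rewrite !mxE; apply: eq_bigr => k _; rewrite !mxE.
exists (\det Z).
  move: uC; rewrite def_C unitmx_mul => /andP[_].
  by rewrite unitmxE det_map_mx unitfE intr_eq0.
move=> _ [t _ <-]; exists (\adj Z *m t) => //.
rewrite def_C map_mxM mulmxA -[B *m _ *m _]mulmxA -map_mxM mul_mx_adj.
by rewrite map_scalar_mx mul_mx_scalar -scalemxAl scaler_int.
Qed.

(** Modulo [K] the integral coordinates matter only modulo [n]. *)
Lemma sublattice_of_multiple B K (n : int) : zmod_closed [in K] ->
  K `<=` int_span B -> n != 0 -> (forall x, int_span B x -> K (x *~ n)) ->
  sublattice K (int_span B).
Proof.
move=> cK KB n_neq0 nK; split=> //.
(* Remainders lie below [`|n|]; the bound [`|n|.+1] makes [inord] available. *)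
pose rep (f : 'cV['I_`|n|.+1]_d) : set 'cV[R]_d :=
  translate (B *m map_mx intr (\col_i (f i 0 : nat)%:Z)) K.
apply: (@sub_finite_set _ _ (rep @` setT)); last first.
  exact/finite_image/finite_finset.
move=> _ [_ [z _ <-] <-].
pose r : 'cV['I_`|n|.+1]_d := \col_i inord `|(z i 0%R %% n)%Z|%N.
exists r => //.
apply: translate_eq => //; rewrite -mulmxBr -map_mxB.
have -> : z - \col_i (r i 0 : nat)%:Z = n *: \col_i (z i 0%R %/ n)%Z.
  apply/colP => i; rewrite !mxE inordK; last first.
    by rewrite ltnS ltnW // -ltz_nat gez0_abs ?modz_ge0 // abszE ltz_mod.
  by rewrite gez0_abs ?modz_ge0 // {1}(divz_eq (z i 0) n) addrK mulrC.
rewrite map_mxZ -scalemxAr scaler_int.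
by apply: nK; exists (\col_i (z i 0%R %/ n)%Z).
Qed.

Lemma sublattice_in_other_lattice B B' H : B \in unitmx ->
  sublattice H (int_span B) -> H `<=` int_span B' -> sublattice H (int_span B').
Proof.
move=> uB subH HB'; have [C uC CH] := sublattice_full_rank uB subH.
have [n n_neq0 nC] := int_span_multiple uC (subset_trans CH HB').
apply: (sublattice_of_multiple _ HB' n_neq0); first by case: subH.
by move=> x /nC/CH.
Qed.

End IntegralSpans.

(** * Affine coincidence isometries *)

Theorem theorem3p3 (R : realType) (d : nat) (G : set 'cV[R]_d)
    (v : 'cV[R]_d) (Q : 'M[R]_d)
    (hG : lattice G) (hvQ : euclidean_group (v, Q)) :
  affine_coincidence_isometry G (v, Q) <->
  OC G Q /\ lattice_sum G (lin_image Q G) v.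
Proof.
have [B uB def_G] := lattice_int_span hG.
have cG : zmod_closed [in G] by rewrite def_G; apply: int_span_subgroup.
have cQG : zmod_closed [in lin_image Q G].
  by rewrite def_G lin_image_int_span; apply: int_span_subgroup.
split=> [[_ [_ [l [H [Gl subH ->]]] CG]]|[[_ [subI _]] [a Ga [_ [b Gb <-] <-]]]].
  have [HG cH _] := subH.
  have [_ [y Gy def_l]] : (G `&` isom_act (v, Q) @` G) l.
    by apply: CG; exists 0; [apply: subgroup0 | rewrite addr0].
  have HQG : H `<=` lin_image Q G.
    move=> h Hh; have [|_ [t Gt def_t]] := CG (l + h); first by exists h.
    exists (t - y); first exact: subgroupB.
    have -> : h = (l + h) - l by rewrite addrAC subrr add0r.
    by rewrite -def_t -def_l /isom_act /= opprD addrACA subrr add0r mulmxBr.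
  have subHQ : sublattice H (lin_image Q G).
    move: subH HQG; rewrite def_G lin_image_int_span.
    exact: sublattice_in_other_lattice.
  have HI : H `<=` G `&` lin_image Q G by move=> h Hh; split; auto.
  have cI := subgroupI cG cQG.
  split; first split=> //.
    by split; [apply: sublatticeS HI _ subH | apply: sublatticeS HI _ subHQ].
  exists l => //; exists (Q *m (0 - y)).
    by exists (0 - y) => //; apply: subgroupB => //; apply: subgroup0.
  by rewrite -def_l /isom_act /= sub0r mulmxN addrK.
split=> //; exists (translate a (G `&` lin_image Q G)).
  by exists a, (G `&` lin_image Q G).
move=> _ [x [Gx [t Gt def_x]] <-]; split; first exact: subgroupD.
exists (t - b); first exact: subgroupB.
by rewrite -def_x /isom_act /= mulmxBr -addrA subrKC.
Qed.
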